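(* Let $\mathbb{T}_1,\mathbb{T}_2$ be time scales, $a_1\in\mathbb{T}_1$, $a_2\in\mathbb{T}_2$, $\tilde{\mathbb{T}}_1=[a_1,\infty)\cap\mathbb{T}_1$, $\tilde{\mathbb{T}}_2=[a_2,\infty)\cap\mathbb{T}_2$. Let $u(t_1,t_2),f(t_1,t_2)\in C(\tilde{\mathbb{T}}_1\times\tilde{\mathbb{T}}_2,\mathbb{R}_0^+)$, and let $a(t_1,t_2)\in C(\tilde{\mathbb{T}}_1\times\tilde{\mathbb{T}}_2,\mathbb{R}^+)$ be nondecreasing in each of the variables. If $p$ and $q$ are two positive real numbers such that $p\ge q$ and if $$u^p(t_1,t_2)\le a(t_1,t_2)+\int_{a_1}^{t_1}\int_{a_2}^{t_2}f(s_1,s_2)u^q(s_1,s_2)\Delta_1s_1\Delta_2s_2$$ for $(t_1,t_2)\in\tilde{\mathbb{T}}_1\times\tilde{\mathbb{T}}_2$, then $$u(t_1,t_2)\le a^{\frac1p}(t_1,t_2)\left[e_{\int_{a_2}^{t_2}f(t_1,s_2)a^{\frac qp-1}(t_1,s_2)\Delta_2s_2}(t_1,a_1)\right]^{\frac1p},\quad(t_1,t_2)\in\tilde{\mathbb{T}}_1\times\tilde{\mathbb{T}}_2.$$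
   Context: $\mathbb{R}_0^+=[0,\infty)$, $\mathbb{R}^+=(0,\infty)$. A time scale is a nonempty closed subset of $\mathbb{R}$, with $\sigma(t)=\inf\{s\in\mathbb{T}:s>t\}$, $\mu(t)=\sigma(t)-t$. $y^\Delta(t)$ is the $\Delta$-derivative: for each $\varepsilon>0$, $|y(\sigma(t))-y(s)-y^\Delta(t)(\sigma(t)-s)|\le\varepsilon|\sigma(t)-s|$ for $s$ near $t$. $\int_c^df\Delta t=F(d)-F(c)$ with $F^\Delta=f$; $\Delta_1,\Delta_2$ refer to $\mathbb{T}_1,\mathbb{T}_2$ (with $s_1$ ranging over $[a_1,t_1)$ and $s_2$ over $[a_2,t_2)$). For an rd-continuous function $P$ with $1+\mu(t)P(t)\ne0$, $e_P(\cdot,t_0)$ is the unique solution of $y^\Delta=P(t)y$, $y(t_0)=1$. In the conclusion, for fixed $t_2$, the exponential is $e_P(t_1,a_1)$ on $\mathbb{T}_1$ with $P(\tau)=\int_{a_2}^{t_2}f(\tau,s_2)a^{\frac qp-1}(\tau,s_2)\Delta_2s_2$. *)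

(* Defs.v *)
From HB Require Import structures.
From mathcomp Require Import all_boot all_order all_algebra.
From mathcomp Require Import all_classical all_reals all_analysis.
Set Implicit Arguments.
Unset Strict Implicit.
Unset Printing Implicit Defensive.
Import Order.TTheory GRing.Theory Num.Theory.
Import numFieldNormedType.Exports.
Local Open Scope classical_set_scope.
Local Open Scope ring_scope.

(* A function on a time scale T is represented by a
   total function on R of which only the values on T matter. *)

Definition time_scale (R : realType) (T : set R) : Prop :=
  closed T /\ T !=set0.

(* [a, oo) intersected with T; it is itself a time scale when a is in T. *)
Definition ts_from (R : realType) (T : set R) (a : R) : set R :=
  T `&` [set t | a <= t].

(* The usual convention inf set0 = sup T is made explicit, because [inf set0]
   is 0 in the library; thus sigma fixes the maximum of T, if there is one. *)
Definition sigma (R : realType) (T : set R) (t : R) : R :=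
  if pselect ([set s | T s /\ t < s] !=set0)
  then inf [set s | T s /\ t < s] else sup T.

(* [l] is a Delta-derivative of [y] at [t].  At a left-scattered maximum of T
   every [l] qualifies, so asking for this at all points of T is the same as
   asking for it on T^kappa. *)
Definition is_delta_derive (R : realType) (T : set R) (y : R -> R) (t l : R) :
    Prop :=
  forall eps : R, 0 < eps ->
    \forall s \near t, T s ->
      `|y (sigma T t) - y s - l * (sigma T t - s)| <= eps * `|sigma T t - s|.

Definition delta_antiderivative (R : realType) (T : set R) (f F : R -> R) :
    Prop :=
  forall t, T t -> is_delta_derive T F t (f t).

(* F d - F c for a chosen antiderivative F of f on T.  The value does not
   depend on the choice for c, d in T; rd-continuous functions, in particular
   continuous ones, have antiderivatives. *)
Definition delta_int (R : realType) (T : set R) (f : R -> R) (c d : R) : R :=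
  let F := xget (fun=> 0) [set F | delta_antiderivative T f F] in F d - F c.

Definition delta_exp_solution (R : realType) (T : set R) (P : R -> R) (t0 : R)
    (y : R -> R) : Prop :=
  (forall t, T t -> is_delta_derive T y t (P t * y t)) /\ y t0 = 1.

(* e_P(t, t0) on T.  For t0 in T and P rd-continuous with
   1 + (sigma t - t) * P t != 0 on T, a solution exists and its values on T
   are unique. *)
Definition delta_exp (R : realType) (T : set R) (P : R -> R) (t t0 : R) : R :=
  xget (fun=> 0) [set y | delta_exp_solution T P t0 y] t.

(* Main.v *)
Require Import Defs.
From HB Require Import structures.
From mathcomp Require Import all_boot all_order all_algebra.
From mathcomp Require Import all_classical all_reals all_analysis.
From mathcomp Require Import measurable_realfun.
From mathcomp Require Import ring lra.
Import Order.TTheory GRing.Theory Num.Theory.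
Import numFieldNormedType.Exports.
Local Open Scope classical_set_scope.
Local Open Scope ring_scope.
(** The proof linearises the nonlinear inequality and then compares with the
exponential, in the first variable only.

Let [G = f u^q / a], let [I t2 s1] be the integral of [G s1] from [a2] to [t2],
and let [z t1 t2] be [1] plus the integral of [I t2] from [a1] to [t1].
As [a] is nondecreasing, the factor [a s1 s2] that was divided out is at most
[a t1 t2], so the hypothesis gives [u^p <= a z].  Hence
[u^q <= a^(q/p) z^(q/p) <= a^(q/p) z], because [z >= 1] and [q <= p].
Since [z] is nondecreasing in its second variable, for fixed [t2] the
Delta-derivative [I t2] of [z] in the first variable is at most [P z], where
[P t] is the integral of [f t * a t ^ (q/p - 1)] from [a2] to [t2].  Therefore
[z <= e_P], and taking [p]-th roots in [u^p <= a z] concludes.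

Three facts about time scales carry this argument.

- [delta_comparison]: if [d c <= 0] and the Delta-derivative of [d] is at most
  [C max(d, 0)], then [d <= 0] after [c].  It is proved by induction along the
  time scale ([time_scale_ind]).  With [C = 0] it gives the monotonicity of the
  Delta-integral; with [d = z - e_P] it gives [z <= e_P].

- Integrals and exponentials exist.  This has to be proved, because
  [delta_int] and [delta_exp] are chosen values that are meaningless
  when nothing can be chosen.  Both come from one Lebesgue integral: a function
  on the time scale is made constant on each gap by composing it with the
  projection [ts_floor] to the left end of the gap.  Integrating [f] itself
  gives an antiderivative ([delta_antiderivative_exists]).  Integrating
  Hilger's cylinder transform of [P] and then taking [expR] gives the
  exponential ([delta_exp_exists]).

- Delta-integrals depend continuously on a parameter
  ([delta_int_parameter_continuous]), by compactness.  This makes [I t2] and [P]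
  continuous, hence gives meaning to their integral and exponential. *)

Set Implicit Arguments.
Unset Strict Implicit.
Unset Printing Implicit Defensive.

(** * Jumps and induction on a time scale *)

(** The properties of [ts_from T a] that the proof needs: all integrals start
at the least point [a], and induction has to start there. *)
Definition rooted_scale (R : realType) (T : set R) (a : R) : Prop :=
  [/\ closed T, T a & forall t, T t -> a <= t].

Lemma rooted_ts_from (R : realType) (T : set R) (a : R) :
  time_scale T -> T a -> rooted_scale (ts_from T a) a.
Proof.
move=> [clT _] Ta; split; last by move=> t [].
- by apply: closedI => //; exact: closed_ge.
- by split => //=.
Qed.

Lemma closed_inf (R : realType) (A B : set R) :
  closed B -> A `<=` B -> A !=set0 -> has_lbound A -> B (inf A).
Proof.
move=> clB AB A0 lbA; apply: clB => V /nbhs_ballP[e /= e0 eV].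
have [x Ax xlt] := inf_adherent e0 (conj A0 lbA).
exists x; split; first exact: AB.
apply: eV; rewrite /ball/= distrC ger0_norm ?subr_ge0; first by lra.
exact: ge_inf.
Qed.

Lemma closed_sup (R : realType) (A B : set R) :
  closed B -> A `<=` B -> A !=set0 -> has_ubound A -> B (sup A).
Proof.
move=> clB AB A0 ubA; apply: clB => V /nbhs_ballP[e /= e0 eV].
have [x Ax xlt] := sup_adherent e0 (conj A0 ubA).
exists x; split; first exact: AB.
apply: eV; rewrite /ball/= ger0_norm ?subr_ge0; first by lra.
exact: ub_le_sup.
Qed.

Section Sigma.
Context {R : realType} {T : set R} {a : R}.
Hypothesis hT : rooted_scale T a.

Lemma sigma_max (t : R) : T t -> (forall s, T s -> s <= t) -> sigma T t = t.
Proof.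
move=> Tt tmax; rewrite /sigma; case: pselect => /= [[s [Ts ts]]|_].
  by move: (tmax s Ts); rewrite leNgt ts.
apply/eqP; rewrite eq_le; apply/andP; split.
  by apply: ge_sup; [exists t|exact: tmax].
by apply: ub_le_sup => //; exists t => s Ts; exact: tmax.
Qed.

Let lbnd t : has_lbound [set s | T s /\ t < s].
Proof. by exists t => s [_ /ltW]. Qed.

Lemma sigma_le (t s : R) : T s -> t < s -> sigma T t <= s.
Proof.
move=> Ts ts; rewrite /sigma; case: pselect => /= [h|]; last by case; exists s.
by apply: ge_inf => //; exact: lbnd.
Qed.

Lemma sigma_ge (t : R) : T t -> t <= sigma T t.
Proof.
move=> Tt; have [[s [Ts ts]]|h] := pselect ([set s | T s /\ t < s] !=set0).
  rewrite /sigma; case: pselect => /= [h|]; last by case; exists s.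
  by apply: lb_le_inf => // r [_ /ltW].
rewrite sigma_max// => s Ts; rewrite leNgt; apply/negP => ts.
by apply: h; exists s.
Qed.

Lemma sigma_in (t : R) : T t -> T (sigma T t).
Proof.
case: hT => clT _ _ Tt.
have [[s [Ts ts]]|h] := pselect ([set s | T s /\ t < s] !=set0).
  rewrite /sigma; case: pselect => /= [h|]; last by case; exists s.
  by apply: (@closed_inf _ [set s | T s /\ t < s]) => // r [].
rewrite sigma_max// => s Ts; rewrite leNgt; apply/negP => ts.
by apply: h; exists s.
Qed.

Lemma le_sigma (s t : R) : T s -> T t -> s <= t -> sigma T s <= sigma T t.
Proof.
move=> Ts Tt; rewrite le_eqVlt => /predU1P[->//|st].
by apply: (le_trans (sigma_le Tt st)); exact: sigma_ge.
Qed.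

Lemma near_scattered (t : R) :
  t < sigma T t -> \forall s \near t, T s -> s <= t.
Proof.
move=> ts; near=> s => Ts; rewrite leNgt; apply/negP => /(sigma_le Ts).
by rewrite leNgt => /negP; apply; near: s; exact: lt_nbhsl.
Unshelve. all: by end_near. Qed.

(** The infimum in the definition of [sigma T t] is then [t] itself, and it is
not attained. *)
Lemma right_dense (t s e : R) : T s -> t < s -> sigma T t <= t -> 0 < e ->
  exists w, [/\ T w, t < w & w < t + e].
Proof.
move=> Ts ts; rewrite /sigma.
case: pselect => /= [h st e0|[]]; last by exists s.
have [w [Tw tw] we] := inf_adherent e0 (conj h (lbnd t)).
by exists w; split => //; rewrite (lt_le_trans we)// lerD2r.
Qed.

(** Points near a non-jumping [t] have small jumps, on either side: from the
left a jump cannot pass over [t], and from the right it cannot pass over the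
points of [T] that accumulate at [t].  The jump of a right-dense limit thus
behaves continuously, although [sigma] does not in general. *)
Lemma graininess_near (t e : R) : T t -> sigma T t <= t -> 0 < e ->
  \forall s \near t, T s -> sigma T s - s <= e.
Proof.
move=> Tt st e0.
have [[w [Tw tw we]]|tmax] :=
    pselect (exists w, [/\ T w, t < w & w < t + e]).
  near=> s => Ts.
  have te : t - e < s by near: s; apply: lt_nbhsr; lra.
  have sw : s < w by near: s; exact: lt_nbhsl.
  have [lst|lts] := ltP s t; first by have := sigma_le Tt lst; lra.
  by have := sigma_le Tw sw; lra.
near=> s => Ts.
have te : t - e < s by near: s; apply: lt_nbhsr; lra.
have [lst|lts|->] := ltgtP s t.
- by have := sigma_le Tt lst; lra.
- by exfalso; apply: tmax; exact: right_dense Ts lts st e0.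
- by lra.
Unshelve. all: by end_near. Qed.

(** Induction along a time scale: look at the infimum [m] of the set of
counterexamples, which lies in [T].  If [Q m] holds, there are counterexamples
just to the right of [m].  If not, [m > a], and [Q] holds on all points before
[m]: either they accumulate at [m], or [m] is the successor of the largest of
them. *)
Lemma time_scale_ind (Q : R -> Prop) :
  Q a ->
  (forall t, T t -> Q t -> Q (sigma T t)) ->
  (forall t, T t -> Q t -> \forall s \near t, T s -> t < s -> Q s) ->
  (forall t, T t ->
     (forall e, 0 < e -> exists s, [/\ T s, t - e < s & s < t]) ->
     (forall s, T s -> s < t -> Q s) -> Q t) ->
  forall t, T t -> Q t.
Proof.
case: (hT) => clT Ta leT Qa Qsigma Qright Qleft t Tt; apply: contrapT => nQt.
pose B := [set s | T s /\ ~ Q s].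
have B0 : B !=set0 by exists t.
have lbB : has_lbound B by exists a => s [Ts _]; exact: leT.
set m := inf B.
have Tm : T m by apply: (@closed_inf _ B) => // s [].
have Qlt s : T s -> s < m -> Q s.
  move=> Ts sm; apply: contrapT => nQs.
  by move: sm; rewrite ltNge ge_inf.
(* If [Q m] holds, the counterexamples close to [m] contradict the step to
   the right. *)
have [Qm|nQm] := pselect (Q m).
  have [e /= e0 he] := (nbhs_ballP _ _).1 (Qright m Tm Qm).
  have [s [Ts nQs] sm] := inf_adherent e0 (conj B0 lbB).
  apply: nQs; have [sm'|sm'|->//] := ltgtP s m; first exact: Qlt.
  apply: he => //; rewrite /ball/= distrC gtr0_norm ?subr_gt0//.
  by rewrite /m in sm *; lra.
have am : a < m.
  by rewrite lt_neqAle leT// andbT; apply/eqP => am; apply: nQm; rewrite -am.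
(* [sup L] is [m] if [m] is left-dense and the predecessor of [m] otherwise. *)
pose L := [set s | T s /\ s < m].
have L0 : L !=set0 by exists a.
have ubL : has_ubound L by exists m => s [_ /ltW].
have Tr : T (sup L) by apply: (@closed_sup _ L) => // s [].
have : sup L <= m by apply: ge_sup => // s [_ /ltW].
rewrite le_eqVlt => /predU1P[rm|rm].
  apply: nQm; apply: Qleft => // e e0.
  have [s [Ts sm] es] := sup_adherent e0 (conj L0 ubL).
  by exists s; split => //; rewrite -rm.
apply: nQm; suff -> : m = sigma T (sup L) by apply: Qsigma => //; exact: Qlt.
apply/eqP; rewrite eq_le sigma_le// andbT leNgt; apply/negP => sm.
have Ls : sigma T (sup L) <= sup L.
  by apply: ub_le_sup => //; split => //; exact: sigma_in.
have mr : 0 < m - sup L by rewrite subr_gt0.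
have [w [Tw Lw wm]] := right_dense Tm rm Ls mr.
have : w <= sup L by apply: ub_le_sup => //; split => //; lra.
by rewrite leNgt Lw.
Qed.

End Sigma.

(** * Delta-derivatives and the comparison principle *)

Lemma near_dist_le (R : realType) (t e : R) :
  0 < e -> \forall s \near t, `|t - s| <= e.
Proof.
by move=> e0; apply/nbhs_ballP; exists e => //= s; rewrite /ball/= => /ltW.
Qed.

Lemma is_delta_derive_lin (R : realType) (T : set R) (y z : R -> R)
    (k t l m : R) :
  is_delta_derive T y t l -> is_delta_derive T z t m ->
  is_delta_derive T (fun s => y s + k * z s) t (l + k * m).
Proof.
move=> hy hz e e0.
have k0 : 0 < `|k| + 1 by rewrite ltr_pwDr.
have e1 : 0 < e / 2 by lra.
have e2 : 0 < e / 2 / (`|k| + 1) by rewrite divr_gt0.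
near=> s => Ts.
have : `|y (sigma T t) - y s - l * (sigma T t - s)| <=
    e / 2 * `|sigma T t - s| by move: Ts; near: s; exact: hy.
have : `|z (sigma T t) - z s - m * (sigma T t - s)| <=
    e / 2 / (`|k| + 1) * `|sigma T t - s| by move: Ts; near: s; exact: hz.
set D := sigma T t - s; set Z := z _ - _ - _; set Y := y _ - _ - _ => hZ hY.
rewrite (_ : _ - _ - _ = Y + k * Z); last by rewrite /Y /Z /D; ring.
rewrite (le_trans (ler_normD _ _))// [e]splitr mulrDl lerD// normrM.
rewrite (le_trans (ler_wpM2l _ hZ))// mulrA ler_wpM2r//.
by rewrite mulrA ler_pdivrMr// mulrC ler_wpM2l ?lerDl// ltW.
Unshelve. all: by end_near. Qed.

Lemma is_delta_derive_cst (R : realType) (T : set R) (c t : R) :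
  is_delta_derive T (fun=> c) t 0.
Proof.
move=> e e0; apply: (filterE (F := nbhs t)) => s _.
by rewrite subrr mul0r subrr normr0 mulr_ge0// ltW.
Qed.

Lemma is_delta_derive_shift (R : realType) (T : set R) (c t : R) :
  is_delta_derive T (fun s => s - c) t 1.
Proof.
move=> e e0; apply: (filterE (F := nbhs t)) => s _.
rewrite (_ : _ - _ - _ = 0); first by rewrite normr0 mulr_ge0// ltW.
by ring.
Qed.

Section DeltaDerive.
Context {R : realType} {T : set R} {a : R}.
Hypothesis hT : rooted_scale T a.

(** The derivative inequality at [s = t] itself bounds the left-hand side by
[eps] times the graininess, for every [eps]. *)
Lemma is_delta_derive_sigma (y : R -> R) (t l : R) :
  T t -> is_delta_derive T y t l ->
  y (sigma T t) = y t + l * (sigma T t - t).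
Proof.
move=> Tt hy; apply/eqP; rewrite -subr_eq0 -normr_le0.
apply/ler_addgt0Pl => e e0.
have D0 : 0 < `|sigma T t - t| + 1 by rewrite ltr_pwDr.
have /nbhs_singleton/(_ Tt) := hy _ (divr_gt0 e0 D0).
rewrite opprD addrA addr0 => /le_trans; apply.
by rewrite mulrAC ler_pdivrMr// ler_wpM2l ?lerDl// ltW.
Qed.

(** Increments from [t] instead of [sigma t].  The error is still measured by
the distance to [sigma t], which does not become small at a jump. *)
Lemma is_delta_derive_increment (y : R -> R) (t l e : R) :
  T t -> is_delta_derive T y t l -> 0 < e ->
  \forall s \near t, T s ->
    `|y s - y t - l * (s - t)| <= e * `|sigma T t - s|.
Proof.
move=> Tt hy e0; near=> s => Ts.
rewrite -[X in X <= _]normrN (_ : - (_ - _) =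
    y (sigma T t) - y s - l * (sigma T t - s)).
  by move: Ts; near: s; exact: hy.
by rewrite (is_delta_derive_sigma Tt hy); ring.
Unshelve. all: by end_near. Qed.

Lemma is_delta_derive_continuous (y : R -> R) (t l e : R) :
  T t -> is_delta_derive T y t l -> 0 < e ->
  \forall s \near t, T s -> `|y s - y t| <= e.
Proof.
move=> Tt hy e0.
set D := sigma T t - t; have D0 : 0 <= D by rewrite subr_ge0 (sigma_ge).
have e1 : 0 < e / 2 / (D + 1) by rewrite !divr_gt0// ltr_wpDl.
have e2 : 0 < e / 2 / (`|l| + 1) by rewrite !divr_gt0// ltr_wpDl.
near=> s => Ts.
have h : `|y s - y t - l * (s - t)| <= e / 2 / (D + 1) * `|sigma T t - s|.
  by move: Ts; near: s; exact: is_delta_derive_increment.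
rewrite (_ : y s - y t = (y s - y t - l * (s - t)) + l * (s - t)); last by ring.
rewrite (le_trans (ler_normD _ _))// [e]splitr lerD//.
  rewrite (le_trans h)// mulrAC ler_pdivrMr ?ltr_wpDl// ler_wpM2l//; first lra.
  rewrite (_ : sigma T t - s = D + (t - s)); last by rewrite /D; ring.
  rewrite (le_trans (ler_normD _ _))// (ger0_norm D0) lerD2l.
  by near: s; exact: (near_dist_le _ ltr01).
have hs : `|s - t| <= e / 2 / (`|l| + 1).
  by rewrite distrC; near: s; exact: near_dist_le.
rewrite normrM mulrC (le_trans (ler_wpM2r _ hs))//.
rewrite mulrAC ler_pdivrMr ?ltr_wpDl//.
by rewrite ler_wpM2l ?lerDl//; lra.
Unshelve. all: by end_near. Qed.

(** Gronwall's lemma in differential form.  For every [e > 0] the function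
[e E], with [E] a real exponential of rate [C + 1], stays above [d]: across a
jump of length [h], since [E] gains there at least the factor [1 + (C + 1) h];
to the right of a dense point, since the rate of [E] exceeds [C] strictly, which
absorbs the error term of the derivative.  Then let [e] tend to [0]. *)
Lemma delta_comparison (d g : R -> R) (c b C : R) :
  0 <= C -> T c ->
  (forall t, T t -> c <= t -> t <= b -> is_delta_derive T d t (g t)) ->
  (forall t, T t -> c <= t -> t <= b -> g t <= C * Num.max (d t) 0) ->
  d c <= 0 -> forall t, T t -> c <= t -> t <= b -> d t <= 0.
Proof.
move=> C0 Tc hd hg dc0 t0 Tt0 ct0 t0b.
apply/ler_addgt0Pl => e' e'0; rewrite addr0.
pose E t := expR ((C + 1) * (t - a)).
have E0 t : 0 < E t by exact: expR_gt0.
have E_step s t : s <= t -> E s * (1 + (C + 1) * (t - s)) <= E t.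
  move=> st; rewrite /E.
  rewrite (_ : _ * (t - a) = (C + 1) * (s - a) + (C + 1) * (t - s)).
    by rewrite expRD ler_wpM2l ?expR_ge0// expR_ge1Dx.
  by ring.
have E_le s t : s <= t -> E s <= E t.
  by move=> st; rewrite ler_expR ler_wpM2l// ?lerD2r//; lra.
(* This [e] makes the bound at [t0] equal to the prescribed [e']. *)
pose e := e' / E t0; have e0 : 0 < e by rewrite divr_gt0.
rewrite (_ : e' = e * E t0); last by rewrite divfK// gt_eqF.
move: t0 Tt0 ct0 t0b @e e0; suff H e : 0 < e ->
    forall t, T t -> c <= t -> t <= b -> d t <= e * E t.
  by move=> t0 Tt0 ct0 t0b e e0; exact: H.
move=> e0; have eE0 t : 0 < e * E t by rewrite mulr_gt0.
have dc : d c <= e * E c by rewrite (le_trans dc0)// ltW.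
have gE t : T t -> c <= t -> t <= b -> d t <= e * E t -> g t <= C * (e * E t).
  move=> Tt ct tb dt; rewrite (le_trans (hg t Tt ct tb))// ler_wpM2l//.
  by rewrite ge_max dt ltW.
apply: (time_scale_ind hT).
- move=> ca _; suff -> : a = c by [].
  by apply/eqP; rewrite eq_le ca andbT; case: hT => _ _; exact.
- move=> t Tt IH cs sb; have ts := sigma_ge Tt.
  have [tc|ct] := ltP t c.
    suff -> : sigma T t = c by [].
    by apply/eqP; rewrite eq_le cs sigma_le.
  have tb := le_trans ts sb; have dt := IH ct tb.
  rewrite (is_delta_derive_sigma Tt (hd t Tt ct tb)).
  have := ler_wpM2l (ltW e0) (E_step t _ ts); apply: le_trans.
  have : g t * (sigma T t - t) <= C * (e * E t) * (sigma T t - t).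
    by rewrite ler_wpM2r ?subr_ge0// gE.
  have : 0 <= e * E t * (sigma T t - t) by rewrite mulr_ge0 ?subr_ge0// ltW.
  by lra.
- move=> t Tt IH; have ts := sigma_ge Tt.
  have [tc|ct] := ltP t c.
    near=> s => _ _ cs; suff : s < c by rewrite ltNge cs.
    by near: s; exact: lt_nbhsl.
  have [bt|tb] := ltP b t.
    by near=> s => Ts ts' _ sb; move: bt; rewrite ltNge (le_trans _ sb)// ltW.
  have dt := IH ct tb.
  near=> s => Ts st _ sb.
  have sg : sigma T t <= s by exact: sigma_le.
  have : `|d s - d t - g t * (s - t)| <= e * E t * `|sigma T t - s|.
    by move: Ts; near: s; apply: is_delta_derive_increment => //; exact: hd.
  rewrite [`|sigma T t - s|]ler0_norm ?subr_le0// => /ler_normlP[_ h].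
  have := ler_wpM2l (ltW e0) (E_step t _ (ltW st)); apply: le_trans.
  have : g t * (s - t) <= C * (e * E t) * (s - t).
    by rewrite ler_wpM2r ?subr_ge0 ?(ltW st)// gE.
  have : e * E t * - (sigma T t - s) <= e * E t * (s - t).
    by rewrite ler_pM2l//; lra.
  by lra.
- move=> t Tt ld IH ct tb; move: ct; rewrite le_eqVlt => /predU1P[<-//|ct].
  apply/ler_addgt0Pl => r r0.
  have [x /= x0 hx] := (nbhs_ballP _ _).1
    (is_delta_derive_continuous Tt (hd t Tt (ltW ct) tb) r0).
  have y0 : 0 < Num.min x (t - c) by rewrite lt_min x0 subr_gt0.
  have [s [Ts ts st]] := ld _ y0.
  move: ts; rewrite ltrBlDr -ltrBlDl lt_min => /andP[tx tc].
  have /(_ Ts)/ler_normlP[h _] : T s -> `|d s - d t| <= r.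
    by apply: hx; rewrite /ball/= gtr0_norm ?subr_gt0//; lra.
  have ds : d s <= e * E s.
    by apply: IH => //; [lra|exact: le_trans (ltW st) tb].
  have : e * E s <= e * E t by rewrite ler_pM2l// E_le// ltW.
  by lra.
Unshelve. all: by end_near. Qed.

End DeltaDerive.

(** * Antiderivatives by Lebesgue integration *)

Definition area (R : realType) (g : R -> R) (a t : R) : R :=
  \int[@lebesgue_measure R]_(r in `[a, t]) g r.

Section Increment.
Context {R : realType} {g : R -> R} {a : R}.
Notation mu := (@lebesgue_measure R).
Hypothesis ig : forall b, mu.-integrable `[a, b] (EFin \o g).

(* The bounds of the interval are a null set, so [g] needs to be controlled only
   strictly between [v] and [w]; at [w = sigma t] this excludes the value of the
   step function after the jump. *)
Let area_increment_le (v w l e : R) : a <= v -> v <= w ->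
  (forall r, v < r < w -> `|g r - l| <= e) ->
  `|area g a w - area g a v - l * (w - v)| <= e * (w - v).
Proof.
move=> av vw hg.
have mu_vw : mu `]v, w[ = (w - v)%:E.
  rewrite lebesgue_measure_itv/= lte_fin; case: ltP => //.
  by move=> wv; rewrite (@le_anti _ _ w v) ?wv// subrr.
have ivw' : mu.-integrable `]v, w] (EFin \o g).
  apply: integrableS (ig w) => //.
  by apply: subset_itvr; rewrite bnd_simp.
have ivw : mu.-integrable `]v, w[ (EFin \o g).
  by apply: integrableS ivw' => //; apply: subset_itvl; rewrite bnd_simp.
have icst (c : R) : mu.-integrable `]v, w[ (EFin \o cst c).
  apply: measurable_bounded_integrable => //=.
    by rewrite [X in (X < _)%E]mu_vw ltry.
  by exists `|c|; split; [exact: num_real|move=> M cM x _ /=; exact: ltW].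
have iB : mu.-integrable `]v, w[ (EFin \o (fun r => g r - l)).
  by apply: (integrableB _ ivw (icst l)).
have cstE c : \int[mu]_(_ in `]v, w[) c = c * (w - v).
  by rewrite Rintegral_cst// [X in fine X]mu_vw.
rewrite /area Rintegral_itvB; [|exact: ig|by rewrite bnd_simp..].
rewrite -Rintegral_itv_bndo_bndc// -cstE -(cstE e).
rewrite -RintegralB//; last exact: icst.
rewrite (le_trans (le_normr_Rintegral _ _))//.
apply: le_Rintegral => //; [exact: (integrable_norm iB)|exact: icst].
Qed.

Lemma area_increment (v w l e : R) : a <= v -> a <= w ->
  (forall r, v < r < w \/ w < r < v -> `|g r - l| <= e) ->
  `|area g a w - area g a v - l * (w - v)| <= e * `|w - v|.
Proof.
move=> av aw hg; have [vw|wv] := leP v w.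
  rewrite [`|w - v|]ger0_norm ?subr_ge0//; apply: area_increment_le => // r rvw.
  by apply: hg; left.
rewrite [`|w - v|]ltr0_norm ?subr_lt0// opprB -[X in X <= _]normrN.
rewrite (_ : - (_ - _) = area g a v - area g a w - l * (v - w)); last by ring.
apply: area_increment_le => // [|r rvw]; first exact: ltW.
by apply: hg; right.
Qed.

End Increment.

Section Floor.
Context {R : realType} {T : set R} {a : R}.
Hypothesis hT : rooted_scale T a.
Notation mu := (@lebesgue_measure R).

(** The maximum with [x] keeps the set nonempty to the left of [x], so that the
function is nondecreasing, hence measurable, on the whole real line. *)
Definition ts_floor (S : set R) (x r : R) : R :=
  sup (S `&` [set t | t <= Num.max r x]).

Notation kappa := (ts_floor T a).

Let ub r : has_ubound (T `&` [set t | t <= Num.max r a]).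
Proof. by exists (Num.max r a) => t []. Qed.

Let ne r : T `&` [set t | t <= Num.max r a] !=set0.
Proof.
by case: hT => _ Ta _; exists a; split => //=; rewrite le_max lexx orbT.
Qed.

Lemma ts_floor_in r : T (kappa r).
Proof.
case: hT => clT _ _.
by apply: (@closed_sup _ (T `&` [set t | t <= Num.max r a])) => // t [].
Qed.

Lemma ts_floor_le r : a <= r -> kappa r <= r.
Proof.
by move=> ar; apply: ge_sup => // t [_ /=]; rewrite max_l.
Qed.

Lemma le_ts_floor s r : T s -> s <= r -> s <= kappa r.
Proof.
by move=> Ts sr; apply: ub_le_sup => //; split => //=; rewrite le_max sr.
Qed.

Lemma ts_floor_nd : nondecreasing_fun kappa.
Proof.
move=> r s rs; apply: ge_sup => // t [Tt /= tr].
apply: ub_le_sup => //; split => //=; rewrite (le_trans tr)//.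
by rewrite ge_max !le_max rs lexx orbT.
Qed.

Lemma ts_floorE t r : T t -> t <= r -> r < sigma T t -> kappa r = t.
Proof.
move=> Tt tr rs; apply/eqP; rewrite eq_le le_ts_floor// andbT leNgt.
apply/negP => /(sigma_le (ts_floor_in r)); rewrite leNgt (le_lt_trans _ rs)//.
by apply: ts_floor_le; rewrite (le_trans _ tr)//; case: hT => _ _; exact.
Qed.

(** The estimate behind all derivatives below: between [s] and [sigma t] the
projection stays between [s] and [t], so that a function composed with it takes
there only values at points close to [t]. *)
Lemma ts_floor_dist s t r : T s -> T t ->
  s < r < sigma T t \/ sigma T t < r < s -> `|kappa r - t| <= `|s - t|.
Proof.
have le_a x : T x -> a <= x by case: hT => _ _; exact.
move=> Ts Tt [/andP[sr rt]|/andP[tr rs]].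
  have [tr|rt'] := leP t r; first by rewrite (ts_floorE Tt tr rt) subrr normr0.
  have sk : s <= kappa r by rewrite le_ts_floor// ltW.
  have kr : kappa r <= r by rewrite ts_floor_le// (le_trans (le_a _ Ts))// ltW.
  by rewrite !ler0_norm; lra.
have tr' : t < r by rewrite (le_lt_trans _ tr)// sigma_ge.
have tk : t <= kappa r by rewrite le_ts_floor// ltW.
have kr : kappa r <= r by rewrite ts_floor_le// (le_trans (le_a _ Tt))// ltW.
by rewrite !ger0_norm; lra.
Qed.

(** [f] is bounded only on the bounded parts of [T]: that suffices for
integrability on each interval. *)
Lemma integrable_ts_floor (f : R -> R) :
  measurable_fun setT (f \o kappa) ->
  (forall b, exists M, forall t, T t -> t <= b -> `|f t| <= M) ->
  forall b, mu.-integrable `[a, b] (EFin \o (f \o kappa)).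
Proof.
move=> mf bf b; apply: measurable_bounded_integrable => //.
- by rewrite /= lebesgue_measure_itv/=; case: ifPn => // _; rewrite ltry.
- exact: measurable_funS mf.
- have [M hM] := bf b; exists M; split; first exact: num_real.
  move=> N MN r /=; rewrite in_itv/= => /andP[ar rb].
  rewrite (le_trans _ (ltW MN))//; apply: hM; first exact: ts_floor_in.
  exact: le_trans (ts_floor_le ar) rb.
Qed.

Lemma measurable_ts_floor : measurable_fun setT kappa.
Proof. by apply: nondecreasing_measurable => //; exact: ts_floor_nd. Qed.

Lemma measurable_comp_ts_floor (f : R -> R) :
  {within T, continuous f} -> measurable_fun setT (f \o kappa).
Proof.
case: (hT) => clT _ _ cf; have mT := closed_measurable clT.
apply: (measurable_comp (F := T)) => //; last exact: measurable_ts_floor.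
- by move=> _ [r _ <-]; exact: ts_floor_in.
- exact: subspace_continuous_measurable_fun.
Qed.

(** The part of [T] in a segment is compact. *)
Lemma within_continuous_bounded (f : R -> R) (b : R) :
  {within T, continuous f} -> exists M, forall t, T t -> t <= b -> `|f t| <= M.
Proof.
case: hT => clT _ leT cf.
have cpt : compact (`[a, b] `&` T).
  by apply: compact_closedI => //; exact: segment_compact.
have cf' : {within `[a, b] `&` T, continuous f}.
  by apply: continuous_subspaceW cf => t [].
have [M [_ hM]] := compact_bounded (continuous_compact cf' cpt).
exists (M + 1) => t Tt tb; apply: (hM (M + 1)); first by rewrite ltrDl.
by exists t => //; split => //=; rewrite in_itv/= tb leT.
Qed.

Lemma within_continuous_near (f : R -> R) (t e : R) :
  {within T, continuous f} -> T t -> 0 < e ->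
  \forall s \near t, T s -> `|f s - f t| <= e.
Proof.
move=> /subspace_continuousP /(_ t) cf Tt e0.
have /cvgrPdist_le /(_ e e0) := cf Tt.
rewrite near_withinE; apply: filterS => s h Ts.
by rewrite distrC h.
Qed.

(** By [ts_floor_dist], the step function [f \o kappa] is close to [f t] between
[s] and [sigma t], hence so is its mean there. *)
Lemma delta_antiderivative_exists (f : R -> R) :
  {within T, continuous f} -> exists F, delta_antiderivative T f F.
Proof.
move=> cf; have ig := integrable_ts_floor (measurable_comp_ts_floor cf)
  (fun b => within_continuous_bounded b cf).
exists (area (f \o kappa) a) => t Tt e e0.
have le_a x : T x -> a <= x by case: hT => _ _; exact.
have [x /= x0 hx] := (nbhs_ballP _ _).1 (within_continuous_near cf Tt e0).
apply/nbhs_ballP; exists x => //= s sx Ts.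
apply: area_increment => //; [exact: le_a| by apply/le_a/(sigma_in hT)|].
move=> r hr; apply: hx; last exact: ts_floor_in.
rewrite /ball/= distrC (le_lt_trans (ts_floor_dist Ts Tt hr))//.
by rewrite distrC.
Qed.

End Floor.

(** * Existence of the exponential *)

(** From [expR (- x) >= 1 - x] follows [expR x (1 - x) <= 1], so the remainder
is at most [x^2 / (1 - x)]. *)
Lemma expR_taylor1 (R : realType) (x : R) :
  `|x| <= 1 / 2 -> `|expR x - 1 - x| <= 2 * x ^+ 2.
Proof.
move=> /ler_normlP[xl xr]; have e0 := expR_gt0 x.
have h1 := expR_ge1Dx x.
rewrite ger0_norm; last by lra.
have h2 : 1 - x <= expR (- x) by have := expR_ge1Dx (- x).
have h3 : expR x * (1 - x) <= 1.
  by rewrite -[leRHS](expRxMexpNx_1 x) ler_wpM2l ?expR_ge0.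
have : (expR x - 1 - x) * (1 - x) <= x ^+ 2.
  rewrite (_ : _ * _ = expR x * (1 - x) - 1 + x ^+ 2); last by ring.
  by lra.
have : 0 <= (expR x - 1 - x) * (1 - x - 1 / 2) by rewrite mulr_ge0//; lra.
by lra.
Qed.

(** Hilger's cylinder transform: the constant rate at which [expR] has to grow
during a jump of length [h] to realise the factor [1 + h p]. *)
Definition cylinder (R : realType) (h p : R) : R :=
  if h == 0 then p else ln (1 + h * p) / h.

Section Cylinder.
Context {R : realType} (h p : R) (h0 : 0 <= h) (p0 : 0 <= p).

Let hp0 : 0 <= h * p. Proof. exact: mulr_ge0. Qed.

Lemma cylinder_ge0 : 0 <= cylinder h p.
Proof.
rewrite /cylinder; case: ifP => // _.
by rewrite divr_ge0// ln_ge0// lerDl.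
Qed.

Lemma cylinder_le : cylinder h p <= p.
Proof.
rewrite /cylinder; case: ifPn => // hn0.
have h1 : 0 < h by rewrite lt_neqAle eq_sym hn0.
by rewrite ler_pdivrMr// [leRHS]mulrC le_ln1Dx// (lt_le_trans _ hp0)// ltrN10.
Qed.

(** Together with [cylinder_le], this shows that the transform tends to [p] as
the jump length tends to [0]. *)
Lemma cylinder_ge : p - h * p ^+ 2 <= cylinder h p.
Proof.
rewrite /cylinder; case: ifPn => [/eqP->|hn0]; first by lra.
have h1 : 0 < h by rewrite lt_neqAle eq_sym hn0.
have d0 : 0 < 1 + h * p by rewrite ltr_pwDl.
have d1 : 0 < (1 + h * p)^-1 by rewrite invr_gt0.
(* With w = 1/(1 + h p): ln w <= w - 1 reads ln (1 + h p) >= 1 - w. *)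
set w := (1 + h * p)^-1; have w0 : 0 < w by rewrite invr_gt0.
have lnw : 1 - w <= ln (1 + h * p).
  have /(@le_ln1Dx R) : -1 < w - 1 by lra.
  by rewrite addrC subrK lnV ?posrE//; lra.
rewrite ler_pdivlMr// (le_trans _ lnw)//.
have wE : (1 + h * p) * w = 1 by rewrite divff// gt_eqF.
(* With [x = h p] and [w (1 + x) = 1], the claim times [h] is
   [x - x^2 <= 1 - w], and the difference of the two sides is [w x^3]. *)
have : 0 <= w * (h * p) ^+ 3 by rewrite mulr_ge0 ?exprn_ge0// ltW.
have -> : w * (h * p) ^+ 3 = ((1 + h * p) * w - 1) * (h * p) ^+ 2
  + (1 - w * (1 + h * p)) * (h * p - 1) + (1 - w) - (p - h * p ^+ 2) * h.
  by ring.
by rewrite (mulrC w) wE; lra.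
Qed.

Lemma expR_cylinder : expR (h * cylinder h p) = 1 + h * p.
Proof.
rewrite /cylinder; case: ifPn => [/eqP->|hn0].
  by rewrite !mul0r expR0 addr0.
by rewrite mulrCA divff// mulr1 lnK// posrE ltr_pwDl.
Qed.

End Cylinder.

Section Exponential.
Context {R : realType} {T : set R} {a : R} (P : R -> R).
Hypotheses (hT : rooted_scale T a) (cP : {within T, continuous P})
  (P0 : forall t, T t -> 0 <= P t).
Notation kappa := (ts_floor T a).

(* The rate of growth at [t].  It may be discontinuous at a left-dense point that
   jumps forward, so its measurability does not follow from continuity. *)
Let L t := cylinder (sigma T t - t) (P t).

Let mu0 t : T t -> 0 <= sigma T t - t.
Proof. by move=> Tt; rewrite subr_ge0 sigma_ge. Qed.

Let L_ge0 t : T t -> 0 <= L t.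
Proof. by move=> Tt; rewrite cylinder_ge0 ?mu0 ?P0. Qed.

Let L_le t : T t -> L t <= P t.
Proof. by move=> Tt; rewrite cylinder_le ?mu0 ?P0. Qed.

Let measurable_L : measurable_fun setT (L \o kappa).
Proof.
have mk := measurable_ts_floor hT.
have mh : measurable_fun setT (fun r => sigma T (kappa r) - kappa r).
  apply: measurable_funB => //; apply: nondecreasing_measurable => // r s rs.
  apply: le_sigma; [exact: ts_floor_in..|exact: ts_floor_nd].
have mP := measurable_comp_ts_floor hT cP.
(* On positive reals the inverse is exp (- ln). *)
rewrite (_ : _ \o _ = (fun r => if sigma T (kappa r) - kappa r == 0
    then (P \o kappa) r
    else ln (1 + (sigma T (kappa r) - kappa r) * (P \o kappa) r) *
         expR (- ln (sigma T (kappa r) - kappa r)))); last first.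
  apply/funext => r; rewrite /= /L /cylinder; case: ifPn => // h0.
  have h1 : 0 < sigma T (kappa r) - kappa r.
    by rewrite lt_neqAle eq_sym h0 mu0//; exact: ts_floor_in.
  by rewrite expRN lnK.
apply: measurable_fun_ifT => //; first exact: measurable_fun_eqr.
apply: measurable_funM.
  apply: measurableT_comp; first exact: measurable_ln.
  by apply: measurable_funD => //; exact: measurable_funM.
apply: measurableT_comp.
  exact: continuous_measurable_fun (@continuous_expR R).
apply: measurableT_comp; first exact: continuous_measurable_fun opp_continuous.
by apply: measurableT_comp => //; exact: measurable_ln.
Qed.

Let ig b : (@lebesgue_measure R).-integrable `[a, b] (EFin \o (L \o kappa)).
Proof.
apply: (integrable_ts_floor hT) => // c.
have [M hM] := within_continuous_bounded hT c cP; exists M => t Tt tc.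
rewrite ger0_norm ?L_ge0// (le_trans (L_le Tt))//.
by rewrite (le_trans (ler_norm _))// hM.
Qed.

Let A t := area (L \o kappa) a t.
Let Y t := expR (A t).

Let le_a t : T t -> a <= t. Proof. by case: hT => _ _; exact. Qed.

(* Between [t] and [sigma t] the rate is exactly [L t]. *)
Let Y_sigma t : T t -> Y (sigma T t) = Y t * (1 + (sigma T t - t) * P t).
Proof.
move=> Tt; rewrite -expR_cylinder ?mu0 ?P0// -expRD; congr expR.
have : `|A (sigma T t) - A t - L t * (sigma T t - t)| <= 0 * `|sigma T t - t|.
  apply: area_increment; [exact: ig|exact: le_a|by apply/le_a/(sigma_in hT)|].
  move=> r [/andP[tr rs]|/andP[st /(lt_trans st)]]; last first.
    by rewrite ltNge sigma_ge.
  by rewrite /= (ts_floorE hT Tt (ltW tr) rs) subrr normr0.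
by rewrite mul0r normr_le0 subr_eq0 subr_eq mulrC addrC => /eqP.
Qed.

(* The bound on [P] is kept with the Lipschitz bound, as both are used with the
   same constant. *)
Let A_lip t : T t -> exists2 C, 0 < C & P t <= C /\
  \forall s \near t, T s -> P s <= C /\ `|A s - A t| <= C * `|s - t|.
Proof.
move=> Tt; have [M hM] := within_continuous_bounded hT (t + 1) cP.
have PM s : T s -> s <= t + 1 -> P s <= `|M| + 1.
  move=> Ts st; rewrite (le_trans (ler_norm _))// (le_trans (hM s Ts st))//.
  by rewrite (le_trans (ler_norm _))// lerDl.
exists (`|M| + 1); first by rewrite ltr_wpDl.
split; first by apply: PM => //; lra.
near=> s => Ts.
have st : s <= t + 1 by near: s; apply: lt_le_nbhsl; lra.
split; first exact: PM.
have := @area_increment _ _ _ ig t s 0 (`|M| + 1) (le_a Tt) (le_a Ts).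
rewrite mul0r subr0; apply => r hr; rewrite subr0 /=.
have Tr := ts_floor_in hT r.
rewrite ger0_norm ?L_ge0// (le_trans (L_le Tr))// PM//.
have ar : a <= r.
  case: hr => /andP[h _]; rewrite (le_trans _ (ltW h))//; exact: le_a.
rewrite (le_trans (ts_floor_le hT ar))//.
case: hr => /andP[_ h]; lra.
Unshelve. all: by end_near. Qed.

(* The rate is continuous at a right-dense point, with value [P t]; the error is
   then small compared with [s - t], which the derivative of [expR A] needs. *)
Let A_dense t e : T t -> sigma T t = t -> 0 < e ->
  \forall s \near t, T s -> `|A s - A t - P t * (s - t)| <= e * `|s - t|.
Proof.
move=> Tt st e0; have [C C0 [_ hC]] := A_lip Tt.
have e1 : 0 < e / 2 by lra.
have e2 : 0 < e / 2 / C ^+ 2 by rewrite divr_gt0 ?exprn_gt0.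
have hL : \forall s \near t, T s -> `|L s - P t| <= e.
  have st' : sigma T t <= t by rewrite st.
  near=> s => Ts.
  have [PC _] : P s <= C /\ `|A s - A t| <= C * `|s - t|.
    by move: Ts; near: s.
  have /ler_normlP[P1 P2] : `|P s - P t| <= e / 2.
    by move: Ts; near: s; exact: within_continuous_near.
  have hs : sigma T s - s <= e / 2 / C ^+ 2.
    by move: Ts; near: s; exact: graininess_near.
  have L1 := L_le Ts.
  have := cylinder_ge (mu0 Ts) (P0 Ts); rewrite -/(L s) => L2.
  have : (sigma T s - s) * P s ^+ 2 <= e / 2.
    rewrite ler_pdivlMr ?exprn_gt0// in hs.
    apply: le_trans hs; rewrite ler_wpM2l ?mu0//.
    by rewrite lerXn2r ?nnegrE ?P0// ltW.
  by move=> h; apply/ler_normlP; split; lra.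
have [x /= x0 hx] := (nbhs_ballP _ _).1 hL.
apply/nbhs_ballP; exists x => //= s sx Ts.
apply: area_increment; [exact: ig|exact: le_a|exact: le_a|].
move=> r hr; apply: hx; last exact: (ts_floor_in hT).
rewrite /ball/= distrC (le_lt_trans (@ts_floor_dist _ _ _ hT s t r Ts Tt _))//.
  by rewrite st; case: hr; [right|left].
by rewrite distrC.
Unshelve. all: by end_near. Qed.

(** The exponential is [expR] of the integral [A] of the rate [L].  Its value
after a jump is exact, so the derivative inequality reduces to an estimate of
[expR (A s - A t) - 1 - P t (s - t)] for [s] near [t].  At a jump the right-hand
side is bounded below, and continuity of [A] is enough.  At a right-dense point
the estimate must be [o(s - t)]: it combines the derivative [P t] of [A] with
the quadratic remainder of [expR]. *)
Lemma delta_exp_exists : exists y, delta_exp_solution T P a y.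
Proof.
exists Y; split; last first.
  by rewrite /Y /A /area set_itv1 Rintegral_set1 expR0.
move=> t Tt e e0; have [C C0 [PC hC]] := A_lip Tt.
have Y0 : 0 < Y t by exact: expR_gt0.
have C1 : 0 < 1 / 2 / C by rewrite !divr_gt0.
suff H : \forall s \near t, T s ->
    Y t * `|expR (A s - A t) - 1 - P t * (s - t)| <= e * `|sigma T t - s|.
  move: H; apply: filterS => s H Ts; apply: le_trans (H Ts).
  have -> : Y (sigma T t) - Y s - P t * Y t * (sigma T t - s) =
      - (Y t * (expR (A s - A t) - 1 - P t * (s - t))).
    rewrite Y_sigma// expRD expRN -/(Y s) -/(Y t).
    by field; rewrite gt_eqF.
  by rewrite normrN normrM (gtr0_norm Y0).
have hx : \forall s \near t, T s ->
    [/\ `|A s - A t| <= 1 / 2, `|A s - A t| <= C * `|s - t| &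
      `|expR (A s - A t) - 1 - (A s - A t)| <= 2 * (A s - A t) ^+ 2].
  near=> s => Ts.
  have [_ hA] : P s <= C /\ `|A s - A t| <= C * `|s - t| by move: Ts; near: s.
  have hs : `|s - t| <= 1 / 2 / C.
    by rewrite distrC; near: s; exact: near_dist_le.
  have h2 : `|A s - A t| <= 1 / 2.
    by rewrite (le_trans hA)// mulrC -ler_pdivlMr.
  by split => //; exact: expR_taylor1.
(* At a jump, [s] lies to the left of [t], so [sigma t - s >= sigma t - t]. *)
have [ts|] := ltP t (sigma T t).
  have e1 : 0 < e * (sigma T t - t) / (3 * C * Y t).
    by rewrite divr_gt0 ?mulr_gt0// subr_gt0.
  near=> s => Ts.
  have st : s <= t by move: Ts; near: s; exact: near_scattered.
  have [h1 h2 h3] : [/\ `|A s - A t| <= 1 / 2, `|A s - A t| <= C * `|s - t| &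
      `|expR (A s - A t) - 1 - (A s - A t)| <= 2 * (A s - A t) ^+ 2].
    by move: Ts; near: s.
  have hs : `|s - t| <= e * (sigma T t - t) / (3 * C * Y t).
    by rewrite distrC; near: s; exact: near_dist_le.
  apply: (@le_trans _ _ (Y t * (3 * C * `|s - t|))).
    rewrite (ler_pM2l Y0).
    have -> : expR (A s - A t) - 1 - P t * (s - t) =
      (expR (A s - A t) - 1 - (A s - A t)) + (A s - A t) - P t * (s - t).
      by ring.
    rewrite (le_trans (ler_normB _ _))//.
    rewrite (le_trans (lerD (ler_normD _ _) (lexx _)))//.
    have : `|P t * (s - t)| <= C * `|s - t|.
      by rewrite normrM ger0_norm ?P0// ler_wpM2r.
    have : 2 * (A s - A t) ^+ 2 <= `|A s - A t|.
      rewrite -real_normK ?num_real// expr2 mulrA ler_piMl//; lra.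
    by lra.
  rewrite [`|sigma T t - s|]gtr0_norm; last by lra.
  have : Y t * (3 * C * `|s - t|) <= e * (sigma T t - t).
    by move: hs; rewrite ler_pdivlMr ?mulr_gt0//; lra.
  move=> /le_trans; apply; rewrite ler_wpM2l//; [exact: ltW|lra].
(* At a right-dense point both error terms get half of [e]. *)
move=> st; have {}st : sigma T t = t by apply/eqP; rewrite eq_le st sigma_ge.
have e1 : 0 < e / 2 / Y t by rewrite !divr_gt0.
have e2 : 0 < e / 2 / (2 * C ^+ 2 * Y t).
  by rewrite !divr_gt0// !mulr_gt0// exprn_gt0.
near=> s => Ts.
have [h1 h2 h3] : [/\ `|A s - A t| <= 1 / 2, `|A s - A t| <= C * `|s - t| &
    `|expR (A s - A t) - 1 - (A s - A t)| <= 2 * (A s - A t) ^+ 2].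
  by move: Ts; near: s.
have hs : `|s - t| <= e / 2 / (2 * C ^+ 2 * Y t).
  by rewrite distrC; near: s; exact: near_dist_le.
have h4 : `|A s - A t - P t * (s - t)| <= e / 2 / Y t * `|s - t|.
  by move: Ts; near: s; exact: A_dense.
rewrite st (distrC t).
have -> : expR (A s - A t) - 1 - P t * (s - t) =
  (expR (A s - A t) - 1 - (A s - A t)) + (A s - A t - P t * (s - t)) by ring.
rewrite (le_trans (ler_wpM2l (ltW Y0) (ler_normD _ _)))// mulrDr.
rewrite [X in _ <= X * _]splitr mulrDl lerD//; last first.
  rewrite (le_trans (ler_wpM2l (ltW Y0) h4))// mulrA mulrCA.
  by rewrite divff ?gt_eqF// mulr1.
rewrite (le_trans (ler_wpM2l (ltW Y0) h3))//.
have : (A s - A t) ^+ 2 <= C ^+ 2 * `|s - t| ^+ 2.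
  rewrite -real_normK ?num_real// -exprMn lerXn2r ?nnegrE//.
  by rewrite mulr_ge0// ltW.
move: hs; rewrite ler_pdivlMr ?mulr_gt0 ?exprn_gt0// => hs h5.
rewrite (@le_trans _ _ (Y t * (2 * (C ^+ 2 * `|s - t| ^+ 2))))//.
  by rewrite !ler_wpM2l// ltW.
by have := ler_wpM2r (normr_ge0 (s - t)) hs; rewrite expr2; lra.
Unshelve. all: by end_near. Qed.

End Exponential.

(** * Continuity and Delta-integrals *)

Lemma within_continuousP_near (R : realType) (T : set R) (f : R -> R) :
  (forall t e, T t -> 0 < e -> \forall s \near t, T s -> `|f s - f t| <= e) ->
  {within T, continuous f}.
Proof.
move=> hf; apply/subspace_continuousP => t Tt; apply/cvgrPdist_le => e e0.
rewrite near_withinE; apply: filterS (hf t e Tt e0) => s h Ts.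
by rewrite distrC h.
Qed.

Lemma within_continuous_ball2 (R : realType) (T1 T2 : set R)
    (g : R -> R -> R) (t s e : R) :
  {within T1 `*` T2, continuous (fun z : R * R => g z.1 z.2)} ->
  T1 t -> T2 s -> 0 < e ->
  exists2 x, 0 < x & forall t' s', T1 t' -> T2 s' ->
    `|t - t'| < x -> `|s - s'| < x -> `|g t' s' - g t s| <= e.
Proof.
move=> /subspace_continuousP /(_ (t, s)) cg T1t T2s e0.
have /cvgrPdist_le /(_ e e0) := cg (conj T1t T2s).
rewrite near_withinE => /nbhs_ballP[x /= x0 hx].
exists x => // t' s' T1t' T2s' tt' ss'.
by rewrite distrC; apply: (hx (t', s')).
Qed.

(** A base that vanishes is allowed for positive exponents: it tends to [0]
through nonnegative values, which matters since negative numbers to any power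
are [1]. *)
Lemma within_continuous_powR (R : realType) (U : topologicalType) (A : set U)
    (u : U -> R) (q : R) :
  {within A, continuous u} ->
  (forall x, A x -> 0 <= u x) -> (forall x, A x -> u x = 0 -> 0 < q) ->
  {within A, continuous (fun x => u x `^ q)}.
Proof.
move=> /subspace_continuousP cu u0 q0; apply/subspace_continuousP => x Ax.
rewrite /from_subspace; have {}cu : u @ within A (nbhs x) --> u x := cu x Ax.
have [ux0|ux0] := eqVneq (u x) 0.
  have {}q0 := q0 x Ax ux0; rewrite /= ux0 powR0 ?gt_eqF//.
  apply/cvgrPdist_le => e e0; have e1 : 0 < e `^ q^-1 by rewrite powR_gt0.
  have /cvgrPdist_le /(_ _ e1) := cu; rewrite ux0 !near_withinE.
  apply: filterS => y h Ay; have := h Ay.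
  rewrite !sub0r !normrN !ger0_norm ?powR_ge0 ?u0// => uy.
  have -> : e = (e `^ q^-1) `^ q.
    by rewrite -powRrM mulVf ?gt_eqF// powRr1// ltW.
  by apply: ge0_ler_powR; rewrite ?nnegrE ?u0 ?powR_ge0// ltW.
have {}ux0 : 0 < u x by rewrite lt_neqAle eq_sym ux0 u0.
have /derivable1_diffP/differentiable_continuous :
    derivable (fun y => y `^ q) (u x) 1.
  by apply: derivable_powR; rewrite in_itv/= andbT.
exact: cvg_comp.
Qed.

Section DeltaInt.
Context {R : realType} {T : set R} {a : R}.
Hypothesis hT : rooted_scale T a.

Lemma delta_int_xx (f : R -> R) : delta_int T f a a = 0.
Proof. by rewrite /delta_int subrr. Qed.

Lemma is_delta_derive_int (f : R -> R) (t : R) :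
  {within T, continuous f} -> T t ->
  is_delta_derive T (fun t => delta_int T f a t) t (f t).
Proof.
move=> cf Tt e e0.
have hF := xgetPex (fun=> 0) (delta_antiderivative_exists hT cf).
apply: filterS (hF t Tt e e0) => s h Ts.
rewrite (_ : delta_int T f a _ - _ = xget (fun=> 0)
  [set F | delta_antiderivative T f F] (sigma T t) - xget (fun=> 0)
  [set F | delta_antiderivative T f F] s); first exact: h.
by rewrite /delta_int; ring.
Qed.

(** One inequality serves three purposes: monotonicity ([c = 1], [e = 0]),
taking a constant factor out of the integral ([e = 0]) and stability under
uniform perturbations ([c = 1]).  It is the comparison principle with rate [0]
for the difference of the two sides as functions of [b]. *)
Lemma delta_int_le_affine (f g : R -> R) (c e b : R) :
  {within T, continuous f} -> {within T, continuous g} -> T b ->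
  (forall t, T t -> t <= b -> f t <= c * g t + e) ->
  delta_int T f a b <= c * delta_int T g a b + e * (b - a).
Proof.
move=> cf cg Tb fg; have [_ Ta le_a] := hT.
suff : delta_int T f a b + - c * delta_int T g a b + - e * (b - a) <= 0 by lra.
pose d t := delta_int T f a t + - c * delta_int T g a t + - e * (t - a).
apply: (@delta_comparison _ _ _ hT d (fun t => f t + - c * g t + - e * 1) a b 0)
  => //.
- move=> t Tt _ _; apply: (is_delta_derive_lin (y := fun t => _ + _)).
    by apply: is_delta_derive_lin; exact: is_delta_derive_int.
  exact: is_delta_derive_shift.
- by move=> t Tt _ tb; rewrite mul0r; have := fg t Tt tb; lra.
- by rewrite /d !delta_int_xx subrr !mulr0 !addr0.
- exact: le_a.
Qed.

Lemma delta_int_nd (f : R -> R) (s t : R) :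
  {within T, continuous f} -> (forall r, T r -> 0 <= f r) ->
  T s -> T t -> s <= t -> delta_int T f a s <= delta_int T f a t.
Proof.
move=> cf f0 Ts Tt st.
pose d r := delta_int T f a s + - 1 * delta_int T f a r.
suff : d t <= 0 by rewrite /d; lra.
apply: (@delta_comparison _ _ _ hT d (fun r => 0 + - 1 * f r) s t 0) => //.
- move=> r Tr _ _; apply: (is_delta_derive_lin (y := fun=> _)).
    exact: is_delta_derive_cst.
  exact: is_delta_derive_int.
- by move=> r Tr _ _; rewrite mul0r; have := f0 r Tr; lra.
- by rewrite /d; lra.
Qed.

End DeltaInt.

Section ParametricIntegral.
Context {R : realType} {T1 T2 : set R} {a2 : R} (g : R -> R -> R).
Hypotheses (hT2 : rooted_scale T2 a2)
  (cg : {within T1 `*` T2, continuous (fun z : R * R => g z.1 z.2)}).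

Lemma within_continuous_slice (t : R) : T1 t -> {within T2, continuous (g t)}.
Proof.
move=> T1t; apply: within_continuousP_near => s e T2s e0.
have [x x0 hx] := within_continuous_ball2 cg T1t T2s e0.
apply/nbhs_ballP; exists x => //= s' ss' T2s'.
by apply: hx => //; rewrite subrr normr0.
Qed.

(** On the compact part of [T2] up to [t2], [g t'] is uniformly close to [g t]
for [t'] near [t]; then [delta_int_le_affine] is applied in both directions. *)
Lemma delta_int_parameter_continuous (t2 : R) : T2 t2 ->
  {within T1, continuous (fun t => delta_int T2 (g t) a2 t2)}.
Proof.
move=> T2t2; case: (hT2) => clT2 _ le_a2.
apply: within_continuousP_near => t e T1t e0.
(* The extra [1] avoids a division by zero for [t2 = a2]. *)
pose e1 := e / (t2 - a2 + 1).
have ta : 0 <= t2 - a2 by rewrite subr_ge0 le_a2.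
have e1_gt0 : 0 < e1 by rewrite divr_gt0// ltr_wpDl.
have cpt : compact (`[a2, t2] `&` T2).
  by apply: compact_closedI => //; exact: segment_compact.
have hnear : \forall t' \near t, `[a2, t2] `&` T2 `<=`
    [set s | T2 s -> T1 t' -> `|g t' s - g t s| <= e1].
  have /compact_near_coveringP cov := cpt.
  apply: (cov R (nbhs t) (fun t' s => T2 s -> T1 t' -> `|g t' s - g t s| <= e1))
    => s [_ T2s].
  have e2 : 0 < e1 / 2 by rewrite divr_gt0.
  have [x x0 hx] := within_continuous_ball2 cg T1t T2s e2.
  exists (ball s x, ball t x); first by split; exact: nbhsx_ballx.
  move=> [s' t'] [/= ss' tt'] T2s' T1t'.
  have h1 := hx t' s' T1t' T2s' tt' ss'.
  have h2 : `|g t s' - g t s| <= e1 / 2.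
    by apply: hx => //; rewrite subrr normr0.
  rewrite (_ : _ - _ = (g t' s' - g t s) - (g t s' - g t s)); last by ring.
  by rewrite (le_trans (ler_normB _ _))// [e1]splitr lerD.
near=> t' => T1t'.
have gg s : T2 s -> s <= t2 -> `|g t' s - g t s| <= e1.
  move=> T2s st2.
  have h : `[a2, t2] `&` T2 `<=`
      [set s | T2 s -> T1 t' -> `|g t' s - g t s| <= e1].
    by near: t'.
  by apply: (h s) => //; split => //=; rewrite in_itv/= le_a2.
have le_e : e1 * (t2 - a2) <= e.
  by rewrite /e1 mulrAC ler_pdivrMr ?ltr_wpDl// ler_wpM2l ?lerDl// ltW.
have /= h1 := @delta_int_le_affine _ _ _ hT2 (g t') (g t) 1 e1 t2
  (within_continuous_slice T1t') (within_continuous_slice T1t) T2t2.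
have /= h2 := @delta_int_le_affine _ _ _ hT2 (g t) (g t') 1 e1 t2
  (within_continuous_slice T1t) (within_continuous_slice T1t') T2t2.
apply/ler_normlP; split.
  have := h2 _; suff H : forall s, T2 s -> s <= t2 -> g t s <= 1 * g t' s + e1.
    by move/(_ H); lra.
  by move=> s T2s st; have /ler_normlP[] := gg s T2s st; lra.
have := h1 _; suff H : forall s, T2 s -> s <= t2 -> g t' s <= 1 * g t s + e1.
  by move/(_ H); lra.
by move=> s T2s st; have /ler_normlP[] := gg s T2s st; lra.
Unshelve. all: by end_near. Qed.

End ParametricIntegral.

(** * The inequality in two variables *)

Lemma ge1_powR_le (R : realType) (x r : R) :
  1 <= x -> r <= 1 -> x `^ r <= x.
Proof.
move=> x1 r1; rewrite -[leRHS]powRr1; last by rewrite (le_trans ler01).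
by rewrite ler_powR.
Qed.

Lemma within_continuousM (R : realType) (U : topologicalType) (A : set U)
    (u v : U -> R) :
  {within A, continuous u} -> {within A, continuous v} ->
  {within A, continuous (fun x => u x * v x)}.
Proof.
move=> /subspace_continuousP cu /subspace_continuousP cv.
apply/subspace_continuousP => x Ax.
exact: (cvgM (cu x Ax) (cv x Ax)).
Qed.

Lemma within_continuousV (R : realType) (U : topologicalType) (A : set U)
    (u : U -> R) :
  {within A, continuous u} -> (forall x, A x -> u x != 0) ->
  {within A, continuous (fun x => (u x)^-1)}.
Proof.
move=> /subspace_continuousP cu u0; apply/subspace_continuousP => x Ax.
exact: (cvgV (u0 x Ax) (cu x Ax)).
Qed.

Section TwoVariables.
Context {R : realType} {T1 T2 : set R} {a1 a2 : R} (u f a : R -> R -> R)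
  (p q : R).
Hypotheses (hT1 : rooted_scale T1 a1) (hT2 : rooted_scale T2 a2)
  (cu : {within T1 `*` T2, continuous (fun z : R * R => u z.1 z.2)})
  (cf : {within T1 `*` T2, continuous (fun z : R * R => f z.1 z.2)})
  (ca : {within T1 `*` T2, continuous (fun z : R * R => a z.1 z.2)})
  (u0 : forall t1 t2, T1 t1 -> T2 t2 -> 0 <= u t1 t2)
  (f0 : forall t1 t2, T1 t1 -> T2 t2 -> 0 <= f t1 t2)
  (a0 : forall t1 t2, T1 t1 -> T2 t2 -> 0 < a t1 t2)
  (a_nd1 : forall s1 t1 t2, T1 s1 -> T1 t1 -> T2 t2 -> s1 <= t1 ->
     a s1 t2 <= a t1 t2)
  (a_nd2 : forall t1 s2 t2, T1 t1 -> T2 s2 -> T2 t2 -> s2 <= t2 ->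
     a t1 s2 <= a t1 t2)
  (p0 : 0 < p) (q0 : 0 < q) (qp : q <= p)
  (hu : forall t1 t2, T1 t1 -> T2 t2 ->
     u t1 t2 `^ p <= a t1 t2 + delta_int T1 (fun s1 =>
       delta_int T2 (fun s2 => f s1 s2 * u s1 s2 `^ q) a2 t2) a1 t1).

Let F s1 s2 := f s1 s2 * u s1 s2 `^ q.
Let G s1 s2 := F s1 s2 / a s1 s2.
Let K s1 s2 := f s1 s2 * a s1 s2 `^ (q / p - 1).
Let P t2 s1 := delta_int T2 (K s1) a2 t2.
Let I t2 s1 := delta_int T2 (G s1) a2 t2.
Let z t1 t2 := 1 + delta_int T1 (I t2) a1 t1.

Let cF : {within T1 `*` T2, continuous (fun x : R * R => F x.1 x.2)}.
Proof.
have cuq : {within T1 `*` T2, continuous (fun x : R * R => u x.1 x.2 `^ q)}.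
  by apply: within_continuous_powR => // x [/= h1 h2]; exact: u0.
exact: within_continuousM cf cuq.
Qed.

Let cG : {within T1 `*` T2, continuous (fun x : R * R => G x.1 x.2)}.
Proof.
apply: within_continuousM cF _; apply: within_continuousV ca _.
by move=> x [h1 h2]; rewrite gt_eqF// a0.
Qed.

Let cK : {within T1 `*` T2, continuous (fun x : R * R => K x.1 x.2)}.
Proof.
have cap : {within T1 `*` T2,
    continuous (fun x : R * R => a x.1 x.2 `^ (q / p - 1))}.
  apply: within_continuous_powR => // x [/= h1 h2]; first exact/ltW/a0.
  by move=> ax0; have := a0 h1 h2; rewrite ax0 ltxx.
exact: within_continuousM cf cap.
Qed.

Let F0 t1 t2 : T1 t1 -> T2 t2 -> 0 <= F t1 t2.
Proof. by move=> h1 h2; rewrite mulr_ge0 ?powR_ge0// f0. Qed.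

Let G0 t1 t2 : T1 t1 -> T2 t2 -> 0 <= G t1 t2.
Proof. by move=> h1 h2; rewrite divr_ge0 ?F0// ltW// a0. Qed.

Let K0 t1 t2 : T1 t1 -> T2 t2 -> 0 <= K t1 t2.
Proof. by move=> h1 h2; rewrite mulr_ge0 ?powR_ge0// f0. Qed.

Let cI t2 : T2 t2 -> {within T1, continuous (I t2)}.
Proof. exact: delta_int_parameter_continuous. Qed.

Let I_nd s2 t2 t1 : T1 t1 -> T2 s2 -> T2 t2 -> s2 <= t2 -> I s2 t1 <= I t2 t1.
Proof.
move=> h1 hs ht st; apply: (delta_int_nd hT2) => //.
- exact: (within_continuous_slice cG).
- by move=> r hr; exact: G0.
Qed.

Let I_ge0 t2 t1 : T1 t1 -> T2 t2 -> 0 <= I t2 t1.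
Proof.
have [_ Ta2 le_a2] := hT2.
by move=> h1 h2; rewrite -(@delta_int_xx _ T2 a2 (G t1)) I_nd// le_a2.
Qed.

Let P0 t2 : T2 t2 -> forall t1, T1 t1 -> 0 <= P t2 t1.
Proof.
have [_ Ta2 le_a2] := hT2; move=> h2 t1 h1.
rewrite -(@delta_int_xx _ T2 a2 (K t1)); apply: (delta_int_nd hT2) => //.
- exact: (within_continuous_slice cK).
- by move=> r hr; exact: K0.
- exact: le_a2.
Qed.

Let cP t2 : T2 t2 -> {within T1, continuous (P t2)}.
Proof. exact: delta_int_parameter_continuous. Qed.

Let z_ge1 t1 t2 : T1 t1 -> T2 t2 -> 1 <= z t1 t2.
Proof.
have [_ Ta1 le_a1] := hT1.
move=> h1 h2; rewrite lerDl -(@delta_int_xx _ T1 a1 (I t2)).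
apply: (delta_int_nd hT1) => //; [exact: cI|by move=> r hr; exact: I_ge0|].
exact: le_a1.
Qed.

Let z_nd t1 s2 t2 : T1 t1 -> T2 s2 -> T2 t2 -> s2 <= t2 -> z t1 s2 <= z t1 t2.
Proof.
move=> h1 hs ht st; rewrite lerD2l.
have := @delta_int_le_affine _ _ _ hT1 (I s2) (I t2) 1 0 t1 (cI hs) (cI ht) h1.
rewrite mul1r mul0r addr0; apply => r hr _.
by rewrite mul1r addr0 I_nd.
Qed.

(* Dividing by [a] inside the integrals costs at most the factor [a t1 t2]
   outside, because [a] is nondecreasing in both variables. *)
Let u_le_az t1 t2 : T1 t1 -> T2 t2 -> u t1 t2 `^ p <= a t1 t2 * z t1 t2.
Proof.
move=> h1 h2; rewrite (le_trans (hu h1 h2))// mulrDr mulr1 lerD2l.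
have cJ : {within T1, continuous (fun s1 => delta_int T2 (F s1) a2 t2)}.
  exact: delta_int_parameter_continuous.
have := @delta_int_le_affine _ _ _ hT1 _ (I t2) (a t1 t2) 0 t1 cJ (cI h2) h1.
rewrite mul0r addr0; apply => s1 hs1 st1; rewrite addr0.
have := @delta_int_le_affine _ _ _ hT2 (F s1) (G s1) (a t1 t2) 0 t2
  (within_continuous_slice cF hs1) (within_continuous_slice cG hs1) h2.
rewrite mul0r addr0; apply => s2 hs2 st2; rewrite addr0.
have as0 := a0 hs1 hs2.
rewrite /G mulrCA ler_peMr ?F0// ler_pdivlMr// mul1r.
by rewrite (le_trans (a_nd1 hs1 h1 hs2 st1))// a_nd2.
Qed.

(* The nonlinearity disappears here: [z >= 1] and [q / p <= 1] give
   [z ^ (q / p) <= z]. *)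
Let G_le t1 t2 : T1 t1 -> T2 t2 -> G t1 t2 <= z t1 t2 * K t1 t2.
Proof.
move=> h1 h2; have at0 := a0 h1 h2; have zt1 := z_ge1 h1 h2.
have z0 : 0 <= z t1 t2 by rewrite (le_trans ler01).
have -> : K t1 t2 = f t1 t2 * a t1 t2 `^ (q / p) / a t1 t2.
  rewrite /K powRB ?powRr1 ?ltW//; first by rewrite mulrA.
  by rewrite (gt_eqF at0) implybT.
rewrite /G mulrA; apply: ler_wpM2r; first by rewrite invr_ge0 ltW.
rewrite /F mulrCA; apply: ler_wpM2l; first exact: f0.
have -> : u t1 t2 `^ q = (u t1 t2 `^ p) `^ (q / p).
  by rewrite -powRrM mulrCA divff ?mulr1// gt_eqF.
apply: (@le_trans _ _ ((a t1 t2 * z t1 t2) `^ (q / p))).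
  apply: ge0_ler_powR; rewrite ?nnegrE ?powR_ge0//.
  - by rewrite divr_ge0// ltW.
  - by rewrite mulr_ge0// ltW.
  - exact: u_le_az.
rewrite powRM//; last exact: ltW.
rewrite mulrC ler_wpM2r ?powR_ge0// ge1_powR_le//.
by rewrite ler_pdivrMr// mul1r.
Qed.

(* The comparison applies to any solution of the exponential equation, so the
   one chosen by [delta_exp] need not be identified. *)
Let z_le_exp y t1 t2 : T1 t1 -> T2 t2 ->
  delta_exp_solution T1 (P t2) a1 y -> z t1 t2 <= y t1.
Proof.
move=> h1 h2 [dy y1]; have [_ Ta1 le_a1] := hT1.
have [M hM] := within_continuous_bounded hT1 t1 (cP h2).
have dz s : T1 s -> is_delta_derive T1 (z^~ t2) s (I t2 s).
  move=> hs; have := is_delta_derive_lin 1 (is_delta_derive_cst T1 1 s)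
    (is_delta_derive_int hT1 (cI h2) hs).
  rewrite add0r mul1r; congr (is_delta_derive _ _ _ _).
  by apply/funext => r; rewrite mul1r.
have I_le s : T1 s -> I t2 s <= P t2 s * z s t2.
  move=> hs; rewrite mulrC.
  have := @delta_int_le_affine _ _ _ hT2 (G s) (K s) (z s t2) 0 t2
    (within_continuous_slice cG hs) (within_continuous_slice cK hs) h2.
  rewrite mul0r addr0; apply => s2 hs2 st2; rewrite addr0.
  rewrite (le_trans (G_le hs hs2))// ler_wpM2r ?K0//.
  exact: z_nd.
suff : z t1 t2 + - 1 * y t1 <= 0 by lra.
apply: (@delta_comparison _ _ _ hT1 (fun s => z s t2 + - 1 * y s)
  (fun s => I t2 s + - 1 * (P t2 s * y s)) a1 t1 `|M|) => //.
- by move=> s hs _ _; apply: is_delta_derive_lin; [exact: dz|exact: dy].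
- move=> s hs _ st; set d := z s t2 + _.
  apply: (@le_trans _ _ (P t2 s * d)).
    by have := I_le s hs; rewrite /d; lra.
  rewrite (@le_trans _ _ (P t2 s * Num.max d 0))//.
    by rewrite ler_wpM2l ?(P0 h2)// le_max lexx.
  rewrite ler_wpM2r ?le_max ?lexx ?orbT//.
  by rewrite (le_trans (ler_norm _))// (le_trans (hM s hs st))// ler_norm.
- by rewrite /z delta_int_xx y1; lra.
- exact: le_a1.
Qed.

(** The last step takes [p]-th roots in [u^p <= a z <= a e_P].  The solution
behind [delta_exp] exists because [P] is continuous and nonnegative. *)
Lemma two_variable_gronwall t1 t2 : T1 t1 -> T2 t2 ->
  u t1 t2 <= a t1 t2 `^ (1 / p) * delta_exp T1 (P t2) t1 a1 `^ (1 / p).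
Proof.
move=> h1 h2.
have hy := xgetPex (fun=> 0) (delta_exp_exists hT1 (cP h2) (P0 h2)).
have zy := z_le_exp h1 h2 hy.
have zt1 := z_ge1 h1 h2; have at0 := a0 h1 h2.
have y0 : 0 <= delta_exp T1 (P t2) t1 a1.
  by rewrite (le_trans _ zy)// (le_trans ler01).
rewrite -powRM//; last exact: ltW.
have -> : u t1 t2 = (u t1 t2 `^ p) `^ (1 / p).
  by rewrite -powRrM mulrCA divff ?gt_eqF// mulr1 powRr1// u0.
apply: ge0_ler_powR; rewrite ?nnegrE ?powR_ge0//.
- by rewrite divr_ge0// ltW.
- by rewrite mulr_ge0// ltW.
- by rewrite (le_trans (u_le_az h1 h2))// ler_wpM2l// ltW.
Qed.

End TwoVariables.

Unset Implicit Arguments.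

Theorem theorem130 (R : realType) (T1 T2 : set R) (a1 a2 : R)
  (hT1 : time_scale T1) (hT2 : time_scale T2) (ha1 : T1 a1) (ha2 : T2 a2)
  (u f a : R -> R -> R)
  (u_cont : {within ts_from T1 a1 `*` ts_from T2 a2,
               continuous (fun z : R * R => u z.1 z.2)})
  (f_cont : {within ts_from T1 a1 `*` ts_from T2 a2,
               continuous (fun z : R * R => f z.1 z.2)})
  (a_cont : {within ts_from T1 a1 `*` ts_from T2 a2,
               continuous (fun z : R * R => a z.1 z.2)})
  (u_ge0 : forall t1 t2, ts_from T1 a1 t1 -> ts_from T2 a2 t2 -> 0 <= u t1 t2)
  (f_ge0 : forall t1 t2, ts_from T1 a1 t1 -> ts_from T2 a2 t2 -> 0 <= f t1 t2)
  (a_gt0 : forall t1 t2, ts_from T1 a1 t1 -> ts_from T2 a2 t2 -> 0 < a t1 t2)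
  (a_nd1 : forall s1 t1 t2, ts_from T1 a1 s1 -> ts_from T1 a1 t1 ->
     ts_from T2 a2 t2 -> s1 <= t1 -> a s1 t2 <= a t1 t2)
  (a_nd2 : forall t1 s2 t2, ts_from T1 a1 t1 -> ts_from T2 a2 s2 ->
     ts_from T2 a2 t2 -> s2 <= t2 -> a t1 s2 <= a t1 t2)
  (p q : R) (p_gt0 : 0 < p) (q_gt0 : 0 < q) (q_le_p : q <= p)
  (u_bound : forall t1 t2, ts_from T1 a1 t1 -> ts_from T2 a2 t2 ->
     u t1 t2 `^ p <= a t1 t2 +
       delta_int (ts_from T1 a1) (fun s1 =>
         delta_int (ts_from T2 a2) (fun s2 => f s1 s2 * u s1 s2 `^ q) a2 t2)
         a1 t1) :
  forall t1 t2, ts_from T1 a1 t1 -> ts_from T2 a2 t2 ->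
    u t1 t2 <= a t1 t2 `^ (1 / p) *
      delta_exp (ts_from T1 a1) (fun tau =>
        delta_int (ts_from T2 a2)
          (fun s2 => f tau s2 * a tau s2 `^ (q / p - 1)) a2 t2)
        t1 a1 `^ (1 / p).
Proof.
move=> t1 t2 h1 h2.
have rT1 := rooted_ts_from hT1 ha1; have rT2 := rooted_ts_from hT2 ha2.
exact: (two_variable_gronwall rT1 rT2 u_cont f_cont a_cont u_ge0 f_ge0 a_gt0
  a_nd1 a_nd2 p_gt0 q_gt0 q_le_p u_bound h1 h2).
Qed.
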